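(* Let $\Sigma$ be a (possibly infinite) set of atoms. For every propositional theory $T$ over $\Sigma$ there exists a logic program $\Pi$ over $\Sigma$ such that $T$ and $\Pi$ are strongly equivalent.
   Context: Syntax. Propositional formulas over $\Sigma$ are built from atoms of $\Sigma$ with the connectives $\bot,\vee,\wedge,\to$. Abbreviations: $\neg F := F\to\bot$, $\top := \bot\to\bot$. A propositional theory is a (possibly infinite) set of propositional formulas. A nested expression is a propositional formula containing no implication $F\to G$ with $G\neq\bot$ (so negations and $\top$ are allowed). A rule is a formula $F\to G$ where $F$ and $G$ are nested expressions; a nested expression $G$ is also implicitly regarded as the rule $\top\to G$. A logic program is a propositional theory consisting of rules. Semantics. A classical interpretation is a set $X\subseteq\Sigma$ (the true atoms); $X\models F$ denotes classical satisfaction. An interpretation in the logic of here-and-there (HT) is a pair $(X,Y)$ with $X\subseteq Y\subseteq\Sigma$. Satisfaction $(X,Y)\models F$ is defined recursively: $(X,Y)\models a$ iff $a\in X$ for an atom $a$; $(X,Y)\not\models\bot$; $(X,Y)\models F\wedge G$ iff $(X,Y)\models F$ and $(X,Y)\models G$; $(X,Y)\models F\vee G$ iff $(X,Y)\models F$ or $(X,Y)\models G$; $(X,Y)\models F\to G$ iff both ($(X,Y)\models F$ implies $(X,Y)\models G$) and $Y\models F\to G$ classically. An interpretation is a model of a theory if it satisfies all its formulas, written $(X,Y)\models T$. A set $Y$ of atoms is an answer set (equilibrium model) of a theory $T$ if for every $X\subseteq Y$: $(X,Y)\models T$ iff $X=Y$. Two theories $T_1,T_2$ are strongly equivalent if for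 every theory $T$, $T_1\cup T$ and $T_2\cup T$ have the same answer sets. It is a known result (Lifschitz, Pearce, Valverde) that $T_1,T_2$ are strongly equivalent iff they have the same HT models. *)

(* Defs.v *)
From mathcomp Require Import all_boot.
From mathcomp Require Import boolp classical_sets.

Set Implicit Arguments.
Unset Strict Implicit.
Unset Printing Implicit Defensive.

Local Open Scope classical_set_scope.

Inductive formula (Sigma : Type) : Type :=
| Atom of Sigma
| Bot
| Or of formula Sigma & formula Sigma
| And of formula Sigma & formula Sigma
| Imp of formula Sigma & formula Sigma.

Arguments Bot {Sigma}.

Definition theory (Sigma : Type) : Type := set (formula Sigma).

(* The only implications allowed in a nested expression are negations
   F -> bot; in particular the abbreviation top := bot -> bot is nested. *)
Fixpoint nested_expression (Sigma : Type) (F : formula Sigma) : Prop :=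
  match F with
  | Atom _ => True
  | Bot => True
  | Or F1 F2 => nested_expression F1 /\ nested_expression F2
  | And F1 F2 => nested_expression F1 /\ nested_expression F2
  | Imp F1 F2 => nested_expression F1 /\ F2 = Bot
  end.

(* A nested expression G used as a rule is shorthand for Imp (Imp Bot Bot) G,
   so it needs no clause of its own. *)
Definition rule (Sigma : Type) (H : formula Sigma) : Prop :=
  exists F G : formula Sigma,
    [/\ nested_expression F, nested_expression G & H = Imp F G].

Definition logic_program (Sigma : Type) (P : theory Sigma) : Prop :=
  forall H, P H -> rule H.

Fixpoint sat (Sigma : Type) (X : set Sigma) (F : formula Sigma) : Prop :=
  match F with
  | Atom a => X a
  | Bot => False
  | Or F1 F2 => sat X F1 \/ sat X F2
  | And F1 F2 => sat X F1 /\ sat X F2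
  | Imp F1 F2 => sat X F1 -> sat X F2
  end.

(* Defined for arbitrary X and Y; (X, Y) is an interpretation of the logic of
   here-and-there only when X `<=` Y, which is required where this is used. *)
Fixpoint ht_sat (Sigma : Type) (X Y : set Sigma) (F : formula Sigma) : Prop :=
  match F with
  | Atom a => X a
  | Bot => False
  | Or F1 F2 => ht_sat X Y F1 \/ ht_sat X Y F2
  | And F1 F2 => ht_sat X Y F1 /\ ht_sat X Y F2
  | Imp F1 F2 => (ht_sat X Y F1 -> ht_sat X Y F2) /\ sat Y (Imp F1 F2)
  end.

Definition ht_model (Sigma : Type) (X Y : set Sigma) (T : theory Sigma) : Prop :=
  forall F, T F -> ht_sat X Y F.

Definition answer_set (Sigma : Type) (T : theory Sigma) (Y : set Sigma) : Prop :=
  forall X : set Sigma, X `<=` Y -> (ht_model X Y T <-> X = Y).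

Definition strongly_equivalent (Sigma : Type) (T1 T2 : theory Sigma) : Prop :=
  forall (T : theory Sigma) (Y : set Sigma),
    answer_set (T1 `|` T) Y <-> answer_set (T2 `|` T) Y.

(* Main.v *)
Require Import Defs.
From mathcomp Require Import all_boot.
From mathcomp Require Import boolp classical_sets.
From Stdlib Require List.

(** Every HT countermodel (X, Y) of F is excluded by a rule that F entails.
    On the finitely many atoms of F, the body of this rule says that the "there"
    world agrees with Y and that the "here" world includes X; the head says that
    some atom of Y \ X is true here.  So an interpretation violating the rule
    agrees with (X, Y), or with (Y, Y) when X and Y coincide, on the atoms of F,
    and hence violates F.  The program consists of all the rules entailed by
    some formula of T. *)

Set Implicit Arguments.
Unset Strict Implicit.
Unset Printing Implicit Defensive.

Local Open Scope classical_set_scope.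

Section HereAndThere.
Variable Sigma : Type.
Implicit Types (X Y : set Sigma) (F G : formula Sigma) (l : seq Sigma).

Lemma ht_sat_total Y F : ht_sat Y Y F <-> sat Y F.
Proof. by elim: F => //= F1 IH1 F2 IH2; tauto. Qed.

(** This form treats the worlds [(X, Y)] and [(Y, Y)] alike, so one argument can serve both halves
    of an implication. *)
Lemma ht_sat_Imp X Y F G :
  ht_sat X Y (Imp F G) <->
  (ht_sat X Y F -> ht_sat X Y G) /\ (ht_sat Y Y F -> ht_sat Y Y G).
Proof. by rewrite /= !(propext (ht_sat_total _ _)). Qed.

Lemma ht_sat_persistent X Y F : X `<=` Y -> ht_sat X Y F -> ht_sat Y Y F.
Proof.
move=> sXY; elim: F => [a|||| F1 _ F2 _] //=; first exact: sXY.
- tauto.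
- tauto.
- by case=> _ h; apply/(ht_sat_total Y (Imp F1 F2)).
Qed.

Fixpoint atoms F : seq Sigma :=
  match F with
  | Atom a => [:: a]
  | Bot => [::]
  | Or F1 F2 | And F1 F2 | Imp F1 F2 => atoms F1 ++ atoms F2
  end.

(** [List.In] is used because [Sigma] is a bare type, with no decidable equality. *)
Definition agree l X X' := forall a, List.In a l -> (X a <-> X' a).

Lemma agree_cat l1 l2 X X' :
  agree (l1 ++ l2) X X' -> agree l1 X X' /\ agree l2 X X'.
Proof. by move=> h; split=> a ha; apply: h; apply/List.in_or_app; tauto. Qed.

Lemma ht_sat_agree F X Y X' Y' :
  agree (atoms F) X X' -> agree (atoms F) Y Y' ->
  (ht_sat X Y F <-> ht_sat X' Y' F).
Proof.
elim: F X Y X' Y' => [a||F1 IH1 F2 IH2|F1 IH1 F2 IH2|F1 IH1 F2 IH2] X Y X' Y' //.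
- by move=> h _; apply: h; left.
- move=> /agree_cat[x1 x2] /agree_cat[y1 y2] /=.
  by have := IH1 _ _ _ _ x1 y1; have := IH2 _ _ _ _ x2 y2; tauto.
- move=> /agree_cat[x1 x2] /agree_cat[y1 y2] /=.
  by have := IH1 _ _ _ _ x1 y1; have := IH2 _ _ _ _ x2 y2; tauto.
- move=> /agree_cat[x1 x2] /agree_cat[y1 y2]; rewrite !ht_sat_Imp.
  have := IH1 _ _ _ _ x1 y1; have := IH2 _ _ _ _ x2 y2.
  (* The second half of an implication lives at [(Y, Y)], hence the induction over arbitrary pairs
     of sets. *)
  by have := IH1 _ _ _ _ y1 y1; have := IH2 _ _ _ _ y2 y2; tauto.
Qed.

Definition Neg F := Imp F Bot.
Definition conj (f : Sigma -> formula Sigma) l :=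
  foldr (fun a => And (f a)) (Neg Bot) l.
Definition disj (f : Sigma -> formula Sigma) l :=
  foldr (fun a => Or (f a)) Bot l.

Lemma nested_conj f l :
  (forall a, nested_expression (f a)) -> nested_expression (conj f l).
Proof. by move=> h; elim: l => //=. Qed.

Lemma nested_disj f l :
  (forall a, nested_expression (f a)) -> nested_expression (disj f l).
Proof. by move=> h; elim: l => //=. Qed.

Lemma ht_sat_conj X Y f l :
  ht_sat X Y (conj f l) <-> forall a, List.In a l -> ht_sat X Y (f a).
Proof.
elim: l => [|b l IH] /=; first by split=> // _; split.
rewrite (propext IH); split=> [[hb h] a [<- //|]|h]; first exact: h.
by split=> [|a ha]; apply: h; [left|right].
Qed.

Lemma ht_sat_disj X Y f l :
  ht_sat X Y (disj f l) <-> exists2 a, List.In a l & ht_sat X Y (f a).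
Proof.
elim: l => [|b l IH] /=; first by split=> // -[].
rewrite (propext IH); split=> [[hb|[a al ha]]|[a [<-|al] ha]].
- by exists b => //; left.
- by exists a => //; right.
- by left.
- by right; exists a.
Qed.

(** In HT, [Neg (Neg (Atom a))] and [Neg (Atom a)] test only the there world. For [a] in [X] the
    plain atom tests both worlds, by inclusion. *)
Definition body_literal X Y a :=
  if `[< X a >] then Atom a
  else if `[< Y a >] then Neg (Neg (Atom a)) else Neg (Atom a).
(** [Bot] is neutral in a disjunction, so it stands in for filtering the list. If [X] and [Y]
    coincide on the list, the rule becomes a constraint. *)
Definition head_literal X Y a :=
  if `[< Y a /\ ~ X a >] then Atom a else Bot.
Definition excluding_rule l X Y :=
  Imp (conj (body_literal X Y) l) (disj (head_literal X Y) l).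

Lemma rule_excluding l X Y : rule (excluding_rule l X Y).
Proof.
exists (conj (body_literal X Y) l), (disj (head_literal X Y) l); split=> //.
- by apply: nested_conj => a; rewrite /body_literal; do 2?case: ifP.
- by apply: nested_disj => a; rewrite /head_literal; case: ifP.
Qed.

Lemma ht_sat_body_literal X Y X' Y' a : X `<=` Y -> X' `<=` Y' ->
  ht_sat X' Y' (body_literal X Y a) <-> (X a -> X' a) /\ (Y a <-> Y' a).
Proof.
move=> /(_ a) sXY /(_ a) sXY'; rewrite /body_literal.
by case: asboolP => Xa; [|case: asboolP => Ya] => /=;
  have [|] := pselect (Y' a); tauto.
Qed.

Lemma ht_sat_head_literal X Y X' Y' a :
  ht_sat X' Y' (head_literal X Y a) <-> [/\ Y a, ~ X a & X' a].
Proof.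
rewrite /head_literal; case: asboolP => h /=; first by split=> [|[]//]; split; tauto.
by split=> // -[ya xa _]; apply: h.
Qed.

(** The body holds at [(X, Y)] itself, while a true head literal would be an atom both outside and
    inside [X]. *)
Lemma excluding_rule_fails l X Y : X `<=` Y ->
  ~ ht_sat X Y (excluding_rule l X Y).
Proof.
move=> sXY /ht_sat_Imp[h _].
have /h/ht_sat_disj[a _ /ht_sat_head_literal[]//] :
  ht_sat X Y (conj (body_literal X Y) l).
by apply/ht_sat_conj => a _; apply/ht_sat_body_literal.
Qed.

Lemma violation_agrees l X Y X' Y' : X `<=` Y -> X' `<=` Y' ->
    ht_sat X' Y' (conj (body_literal X Y) l) ->
    ~ ht_sat X' Y' (disj (head_literal X Y) l) ->
  agree l X X' /\ agree l Y Y'.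
Proof.
move=> sXY sXY' /ht_sat_conj hb hh.
have {}hb a : List.In a l -> (X a -> X' a) /\ (Y a <-> Y' a).
  by move=> /hb /ht_sat_body_literal; apply.
split=> a al; have [hX hY] := hb a al => //.
(* An atom of [X'] lies in [Y'], hence in [Y]; were it outside [X], it would make the head true. *)
split=> // X'a; apply: contrapT => nXa; apply: hh.
apply/ht_sat_disj; exists a => //; apply/ht_sat_head_literal; split=> //.
by apply/hY/sXY'.
Qed.

Lemma excluding_rule_entailed F X Y X' Y' : X `<=` Y -> X' `<=` Y' ->
  ~ ht_sat X Y F -> ht_sat X' Y' F ->
  ht_sat X' Y' (excluding_rule (atoms F) X Y).
Proof.
move=> sXY sXY' nF F'; apply/ht_sat_Imp.
(* The rule may be violated at [(X', Y')] or at [(Y', Y')]; persistence carries [F] to the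
   latter. *)
by split=> hb; apply: contrapT => /(violation_agrees sXY _ hb) [//|hX hY];
  apply: nF; apply/(ht_sat_agree hX hY) => //; apply: ht_sat_persistent F'.
Qed.

(** Answer sets are determined by HT models, and the HT models of a union are the common ones. *)
Lemma ht_equivalent_strongly_equivalent (T1 T2 : theory Sigma) :
  (forall X Y, X `<=` Y -> (ht_model X Y T1 <-> ht_model X Y T2)) ->
  strongly_equivalent T1 T2.
Proof.
move=> h T Y.
have ht_modelU X (T' : theory Sigma) :
    ht_model X Y (T' `|` T) <-> ht_model X Y T' /\ ht_model X Y T.
  split=> [hU|[h1 h2] F [/h1|/h2]//].
  by split=> F TF; apply: hU; [left|right].
by split=> hY X sXY; have := hY X sXY; have := h X Y sXY;
  rewrite !(propext (ht_modelU _ _)); tauto.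
Qed.

End HereAndThere.

Theorem theorem1 (Sigma : Type) (T : theory Sigma) :
  exists P : theory Sigma, logic_program P /\ strongly_equivalent T P.
Proof.
exists [set H | rule H /\ exists2 F, T F &
  forall X Y, X `<=` Y -> ht_sat X Y F -> ht_sat X Y H].
split; first by move=> H [].
apply: ht_equivalent_strongly_equivalent => X Y sXY.
split=> [hT H [_ [F /hT hF FH]]|hP F TF]; first exact: FH.
apply: contrapT => nF; apply: (excluding_rule_fails (l := atoms F) sXY).
apply: hP; split; first exact: rule_excluding.
by exists F => // X' Y' sXY'; apply: excluding_rule_entailed.
Qed.
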